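(* Consider the rigid-body attitude dynamics without disturbance $$J\dot\Omega+\Omega\times J\Omega=u,\qquad \dot R=R\hat\Omega,$$ with $R\in SO(3)$, $\Omega\in\mathbb{R}^3$, and $J\in\mathbb{R}^{3\times3}$ the (symmetric positive definite) inertia matrix. Let $r,v\in\mathbb{R}^3$ be unit vectors, $0^\circ\le\theta\le90^\circ$, $\alpha>0$, and $G=\mathrm{diag}(g_1,g_2,g_3)$ with distinct positive $g_i$. Let a desired attitude command $(R_d,\Omega_d=0)$ be given, with $R_d\in SO(3)$ constant and satisfying the constraint $r^TR_d^Tv<\cos\theta$, and let $k_R,k_\Omega>0$. With $e_R,e_\Omega$ as defined in the context, define the control input $$u=-k_Re_R-k_\Omega e_\Omega+\Omega\times J\Omega .$$ Then the zero equilibrium $(e_R,e_\Omega)=(0,0)$ of the attitude error is asymptotically stable, and the inequality constraint $r^TR(t)^Tv\le\cos\theta$ is satisfied for all $t\ge0$ along closed-loop trajectories starting from an attitude with $r^TR(0)^Tv<\cos\theta$.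
   Context: $SO(3)$ is the group of $3\times3$ rotation matrices. The hat map $\wedge:\mathbb{R}^3\to\mathfrak{so}(3)$ sends $x$ to the skew-symmetric matrix $\hat x=x^\wedge$ with $\hat xy=x\times y$; its inverse is the vee map $\vee$. The vector $r$ is a body-fixed pointing direction and $v$ an inertial direction to be avoided. Definitions (for $R$ with $r^TR^Tv<\cos\theta$): $A(R)=\frac12\mathrm{tr}[G(I-R_d^TR)]$; $B(R)=1-\frac1\alpha\ln\big(\frac{\cos\theta-r^TR^Tv}{1+\cos\theta}\big)$; $\Psi=AB$; $e_{R_A}=\frac12(GR_d^TR-R^TR_dG)^\vee$; $e_{R_B}=\frac{(R^Tv)^\wedge r}{\alpha(r^TR^Tv-\cos\theta)}$; $e_R=e_{R_A}B+A\,e_{R_B}$; $e_\Omega=\Omega$. *)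

(* Defs.v *)
(* Vectors of the three-dimensional space are columns 'cV_3,
   and u^T v is the only entry of the 1 x 1 matrix u^T *m v. *)
From HB Require Import structures.
From mathcomp Require Import all_boot all_order all_algebra.
From mathcomp Require Import all_classical all_reals all_analysis.

Set Implicit Arguments.
Unset Strict Implicit.
Unset Printing Implicit Defensive.

Import Order.TTheory GRing.Theory Num.Theory.
Import numFieldNormedType.Exports.

Local Open Scope classical_set_scope.
Local Open Scope ring_scope.

Section Algebra.
Variable R : realType.
Implicit Types (x y : 'cV[R]_3) (S : 'M[R]_3).

Definition SO3 : set 'M[R]_3 := [set Q | Q^T *m Q = 1%:M /\ \det Q = 1].

Definition posdefmx (n : nat) (M : 'M[R]_n) : Prop :=
  M^T = M /\ forall x : 'cV[R]_n, x != 0 -> 0 < (x^T *m M *m x) 0 0.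

Definition unit_vector x : Prop := (x^T *m x) 0 0 = 1.

Definition mkv (a b c : R) : 'cV[R]_3 := \col_(i < 3) [:: a; b; c]`_i.

Definition crossv x y : 'cV[R]_3 :=
  mkv (x 1 0 * y 2 0 - x 2 0 * y 1 0)
      (x 2 0 * y 0 0 - x 0 0 * y 2 0)
      (x 0 0 * y 1 0 - x 1 0 * y 0 0).

Definition hat x : 'M[R]_3 :=
  \matrix_(i < 3, j < 3)
    (nth [::] [:: [:: 0;         - x 2 0;   x 1 0  ];
                  [:: x 2 0;     0;         - x 0 0];
                  [:: - x 1 0;   x 0 0;     0      ]] i)`_j.

(* Only meaningful on skew-symmetric matrices, where it inverts hat. *)
Definition vee S : 'cV[R]_3 := mkv (S 2 1) (S 0 2) (S 1 0).

Lemma ord3P (P : 'I_3 -> Prop) : P 0 -> P 1 -> P 2 -> forall i, P i.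
Proof.
move=> P0 P1 P2 [[|[|[|//]]] lti].
- by rewrite (_ : Ordinal lti = 0) //; apply/val_inj.
- by rewrite (_ : Ordinal lti = 1) //; apply/val_inj.
- by rewrite (_ : Ordinal lti = 2) //; apply/val_inj.
Qed.

Lemma sum_ord3 (F : 'I_3 -> R) : \sum_i F i = F 0 + F 1 + F 2.
Proof.
rewrite !big_ord_recl big_ord0 addr0 addrA.
by congr (F _ + F _ + F _); apply/val_inj.
Qed.

Lemma hat_crossv x y : hat x *m y = crossv x y.
Proof.
apply/matrixP => i j; rewrite ord1 !mxE sum_ord3 !mxE.
by elim/ord3P: i => /=; rewrite mul0r mulNr ?add0r ?addr0 1?addrC.
Qed.

Lemma hatK : cancel hat vee.
Proof.
by move=> x; apply/matrixP; elim/ord3P => j; rewrite ord1 !mxE /= ?mxE.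
Qed.

Lemma hat_skew x : (hat x)^T = - hat x.
Proof.
by apply/matrixP; elim/ord3P; elim/ord3P; rewrite !mxE /= ?oppr0 ?opprK.
Qed.

Lemma veeK S : S^T = - S -> hat (vee S) = S.
Proof.
move=> /matrixP skewS.
have SE i j : S j i = - S i j by have := skewS i j; rewrite !mxE.
have S0 i : S i i = 0.
  by have /eqP := SE i i; rewrite -addr_eq0 -mulr2n mulrn_eq0 /= => /eqP.
by apply/matrixP; elim/ord3P; elim/ord3P; rewrite !mxE /= ?mxE ?S0 //= -SE.
Qed.

End Algebra.

Section AttitudeErrors.
Variables (R : realType) (G Rd : 'M[R]_3) (r v : 'cV[R]_3) (theta alpha : R).
Implicit Types Q : 'M[R]_3.

Definition pointing Q : R := (r^T *m Q^T *m v) 0 0.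

Definition errA Q : R := 2^-1 * \tr (G *m (1%:M - Rd^T *m Q)).

(* errB and eRB are meant for pointing Q < cos theta; elsewhere they take the
   default values of ln and of division. *)
Definition errB Q : R :=
  1 - alpha^-1 * ln ((cos theta - pointing Q) / (1 + cos theta)).

Definition eRA Q : 'cV[R]_3 :=
  2^-1 *: vee (G *m Rd^T *m Q - Q^T *m Rd *m G).

Definition eRB Q : 'cV[R]_3 :=
  (alpha * (pointing Q - cos theta))^-1 *: (hat (Q^T *m v) *m r).

Definition eR Q : 'cV[R]_3 := errB Q *: eRA Q + errA Q *: eRB Q.

(* The desired angular velocity is zero. *)
Definition eOmega (Om : 'cV[R]_3) : 'cV[R]_3 := Om.

Definition attitude_error (x : 'M[R]_3 * 'cV[R]_3) : 'cV[R]_3 * 'cV[R]_3 :=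
  (eR x.1, eOmega x.2).

Definition control (J : 'M[R]_3) (kR kOmega : R) (x : 'M[R]_3 * 'cV[R]_3) :
    'cV[R]_3 :=
  - (kR *: eR x.1) - kOmega *: eOmega x.2 + crossv x.2 (J *m x.2).

End AttitudeErrors.

Section Dynamics.
Variable R : realType.

(* The time interval [0, T[, with T finite or +oo. *)
Definition horizon (T : \bar R) : set R := [set t | 0 <= t /\ (t%:E < T)%E].

(* x = (attitude, angular velocity) solves on [0, T[ the rigid body equations
   under the state feedback u. At t = 0 only continuity from the right is
   required, the equations then hold there for right derivatives as soon as
   u is continuous at x 0. Nothing is assumed on where the attitude evolves,
   apart from SO(3). *)
Definition rigid_body_trajectory (J : 'M[R]_3)
    (u : 'M[R]_3 * 'cV[R]_3 -> 'cV[R]_3) (T : \bar R)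
    (x : R -> 'M[R]_3 * 'cV[R]_3) : Prop :=
  let Rt t := (x t).1 in let Om t := (x t).2 in
  [/\ (0 < T)%E,
      forall t, horizon T t -> SO3 (Rt t),
      {within horizon T, continuous x} &
      forall t, horizon T t -> 0 < t ->
        [/\ derivable Rt t 1, derivable Om t 1,
            J *m derive1 Om t + crossv (Om t) (J *m Om t) = u (x t) &
            derive1 Rt t = Rt t *m hat (Om t)]].

End Dynamics.

(* Asymptotic stability of the equilibrium x0, measured by the error e, which
   vanishes at x0. The error may have other zeros (here e_R vanishes at every
   critical point of A B), hence the neighbourhood U of x0 for initial states.
   traj T is the set of trajectories defined on [0, T[. *)
Definition asymptotically_stable (R : realType) (X : topologicalType)
    (E : normedModType R) (traj : \bar R -> set (R -> X)) (e : X -> E)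
    (x0 : X) : Prop :=
  [/\ traj +oo%E (fun=> x0), e x0 = 0 &
    exists2 U : set X, nbhs x0 U &
      (forall eps : R, 0 < eps -> exists2 delta : R, 0 < delta &
         forall T x, traj T x -> U (x 0) -> `|e (x 0)| < delta ->
         forall t, horizon T t -> `|e (x t)| < eps) /\
      (exists2 delta : R, 0 < delta &
         forall x, traj +oo%E x -> U (x 0) -> `|e (x 0)| < delta ->
         e (x t) @[t --> +oo] --> (0 : E))].

(* Main.v *)
(* The energy V = Omega^T J Omega / 2 + kR A B decreases along trajectories,
   since e_R is the gradient of A B. If the constraint became active, B would
   blow up while A stays away from 0, which the bound on V forbids.
   With P = Rd^T Q and xi = vee ((P - P^T) / 2), the inner product of xi and
   e_RA is at least (min g) |xi|^2, and A is at most (max g) |xi|^2 near Rd, so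
   that xi . e_R dominates |xi|^2 near Rd: small errors and small energies are
   equivalent there. For N large, N V + xi . J Omega is a strict Lyapunov
   function, which forces V to tend to 0. *)
Require Import Defs.
From HB Require Import structures.
From mathcomp Require Import all_boot all_order all_algebra.
From mathcomp Require Import all_classical all_reals all_analysis.
From mathcomp Require Import ring lra.

Set Implicit Arguments.
Unset Strict Implicit.
Unset Printing Implicit Defensive.

Import Order.TTheory GRing.Theory Num.Theory.
Import numFieldNormedType.Exports.

Local Open Scope classical_set_scope.
Local Open Scope ring_scope.

(** * Rotation matrices *)

Section Rotations.
Variable R : realType.
Implicit Types (x y z : 'cV[R]_3) (P Q S : 'M[R]_3).

(** The energy alone yields stability but not convergence: its derivative, [- kOmega |Omega|^2],
    says nothing about the attitude. Pairing the momentum with xi supplies a negative term in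
    |xi|^2, and with it an explicit rate of decrease, so that no limit set has to be studied.
    Pairing with xi rather than with e_R keeps this term smooth on all of SO(3): its derivative
    involves e_R but no derivative of e_R. Two obstacles shape the rest. The error e_R has zeros
    other than Rd, so a small e_R means a small energy only in a neighbourhood of Rd, and it is the
    energy, through A, that prevents trajectories from leaving this neighbourhood. Moreover B is
    meaningless once the constraint is reached, so every use of the energy presupposes that the
    constraint holds strictly up to that time. Trajectories are given and may be followed beyond
    such a time, hence a first exit argument for the constraint comes before any stability
    argument. *)

Definition dotv (n : nat) (x y : 'cV[R]_n) : R := (x^T *m y) 0 0.

Lemma dotvE x y : dotv x y = x 0 0 * y 0 0 + x 1 0 * y 1 0 + x 2 0 * y 2 0.
Proof. by rewrite /dotv mxE sum_ord3 !mxE. Qed.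

Lemma mulmx3E m n (A : 'M[R]_(m, 3)) (B : 'M[R]_(3, n)) i j :
  (A *m B) i j = A i 0 * B 0 j + A i 1 * B 1 j + A i 2 * B 2 j.
Proof. by rewrite mxE sum_ord3. Qed.

Lemma SO3_mulTmx P : SO3 P -> P^T *m P = 1%:M.
Proof. by case. Qed.

Lemma SO3_mulmxT P : SO3 P -> P *m P^T = 1%:M.
Proof. by case=> /mulmx1C. Qed.

Lemma SO3_trmx_mul P Q : SO3 P -> SO3 Q -> SO3 (P^T *m Q).
Proof.
move=> [PTP detP] [QTQ detQ]; split.
  by rewrite trmx_mul trmxK mulmxA -(mulmxA _ P) (mulmx1C PTP) mulmx1.
by rewrite det_mulmx det_tr detP detQ mulr1.
Qed.

Lemma SO3_adj P : SO3 P -> \adj P = P^T.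
Proof.
move=> [PTP detP]; have := mul_mx_adj P; rewrite detP => /(congr1 (mulmx P^T)).
by rewrite mulmxA PTP mul1mx mulmx1.
Qed.

Lemma det_mx22 (A : 'M[R]_2) : \det A = A 0 0 * A 1 1 - A 0 1 * A 1 0.
Proof.
have l00 : lift 0 0 = 1 :> 'I_2 by exact/val_inj.
have l10 : lift 1 0 = 0 :> 'I_2 by exact/val_inj.
rewrite (expand_det_row _ 0) !big_ord_recl big_ord0 /cofactor !det_mx11 !mxE.
by rewrite /= !l00 !l10 /= /bump /=; ring.
Qed.

(** A rotation is its own cofactor matrix, since its inverse is both its adjugate and its transpose.
    The diagonal entries provide the quadratic relations that orthogonality of the rows alone does
    not give. *)
Lemma SO3_minors P : SO3 P ->
  [/\ P 1 1 * P 2 2 - P 1 2 * P 2 1 = P 0 0,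
      P 0 0 * P 2 2 - P 0 2 * P 2 0 = P 1 1 &
      P 0 0 * P 1 1 - P 0 1 * P 1 0 = P 2 2].
Proof.
move=> /SO3_adj /matrixP adjE.
have l00 : lift 0 0 = 1 :> 'I_3 by exact/val_inj.
have l01 : lift 0 1 = 2 :> 'I_3 by exact/val_inj.
have l10 : lift 1 0 = 0 :> 'I_3 by exact/val_inj.
have l11 : lift 1 1 = 2 :> 'I_3 by exact/val_inj.
have l20 : lift 2 0 = 0 :> 'I_3 by exact/val_inj.
have l21 : lift 2 1 = 1 :> 'I_3 by exact/val_inj.
have := (adjE 0 0, adjE 1 1, adjE 2 2).
rewrite !mxE /cofactor !det_mx22 !mxE !l00 !l01 !l10 !l11 !l20 !l21 /=.
by case=> -[E0 E1] E2; split;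
   [rewrite -[RHS]E0|rewrite -[RHS]E1|rewrite -[RHS]E2];
   rewrite /= ?modn_small //; ring.
Qed.

(** For a rotation by the angle phi about the unit vector n, this is sin phi n. At [Rd^T *m Q] it is
    [eRA] for [G] the identity. *)
Definition axis P : 'cV[R]_3 := 2^-1 *: vee (P - P^T).

Lemma axisE P :
  [/\ axis P 0 0 = (P 2 1 - P 1 2) / 2, axis P 1 0 = (P 0 2 - P 2 0) / 2 &
      axis P 2 0 = (P 1 0 - P 0 1) / 2].
Proof. by rewrite !mxE /= ?mxE; split; rewrite mulrC. Qed.

Lemma SO3_rows P : SO3 P -> forall i j,
  P i 0 * P j 0 + P i 1 * P j 1 + P i 2 * P j 2 = (i == j)%:R.
Proof.
by move=> /SO3_mulmxT /matrixP + i j => /(_ i j); rewrite mulmx3E !mxE.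
Qed.

Lemma SO3_cols P : SO3 P -> forall i j,
  P 0 i * P 0 j + P 1 i * P 1 j + P 2 i * P 2 j = (i == j)%:R.
Proof.
by move=> /SO3_mulTmx /matrixP + i j => /(_ i j); rewrite mulmx3E !mxE.
Qed.

Lemma mxtrace3 P : \tr P = P 0 0 + P 1 1 + P 2 2.
Proof. by rewrite /mxtrace sum_ord3. Qed.

Lemma SO3_le1 P i j : SO3 P -> P i j ^+ 2 <= 1.
Proof.
move=> /SO3_rows /(_ i i); rewrite eqxx /= => H.
by elim/ord3P: j; nra.
Qed.

Lemma SO3_diag_le1 P i : SO3 P -> P i i <= 1.
Proof. by move=> /(@SO3_le1 _ i i); nra. Qed.

(** As the trace is 1 + 2 cos phi, the right-hand side is 4 (1 - cos phi)(1 + cos phi), that is 4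
    sin^2 phi. The minors turn products such as [P 1 2 * P 2 1] into diagonal entries. *)
Lemma SO3_axis_sqr P : SO3 P ->
  4 * dotv (axis P) (axis P) = (3 - \tr P) * (1 + \tr P).
Proof.
move=> SP; have rows := SO3_rows SP; have [M0 M1 M2] := SO3_minors SP.
have [A0 A1 A2] := axisE P.
have := (rows 0 0, rows 1 1, rows 2 2); rewrite !eqxx /= => -[[R0 R1] R2].
rewrite dotvE mxtrace3 A0 A1 A2; lra.
Qed.

(** Rotations have squared Frobenius norm 3, so only the cross term varies. Thus [3 - \tr], to which
    [errA] is comparable, measures the distance to [Rd]. *)
Lemma SO3_dist_sqr P Q : SO3 P -> SO3 Q ->
  \sum_i \sum_j (P i j - Q i j) ^+ 2 = 2 * (3 - \tr (P^T *m Q)).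
Proof.
move=> SP SQ; have rowsP := SO3_rows SP; have rowsQ := SO3_rows SQ.
have := (rowsP 0 0, rowsP 1 1, rowsP 2 2); rewrite !eqxx /= => -[[P0 P1] P2].
have := (rowsQ 0 0, rowsQ 1 1, rowsQ 2 2); rewrite !eqxx /= => -[[Q0 Q1] Q2].
by rewrite !sum_ord3 mxtrace3 !mulmx3E !mxE /=; lra.
Qed.

(* For a rotation by the angle phi about the unit vector n, the symmetric
   off-diagonal entries are (1 - cos phi) n_j n_k and the axis is sin phi n, so
   their product over i, j, k distinct does not depend on i. This is where the
   terms in g_k - g_j cancel. *)
Lemma SO3_axis_eRA (g : 'rV[R]_3) P (m : R) : SO3 P -> (forall i, m <= g 0 i) ->
  m * dotv (axis P) (axis P) <=
    dotv (axis P) (2^-1 *: vee (diag_mx g *m P - P^T *m diag_mx g)).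
Proof.
move=> SP mg; have rows := SO3_rows SP; have cols := SO3_cols SP.
have [A0 A1 A2] := axisE P.
have := (rows 0 0, rows 1 1, rows 2 2); rewrite !eqxx /= => -[[R0 R1] R2].
have := (cols 0 0, cols 1 1, cols 2 2); rewrite !eqxx /= => -[[C0 C1] C2].
have m0 := mg 0; have m1 := mg 1; have m2 := mg 2.
rewrite !dotvE A0 A1 A2 !(mxE, mulmx3E) /= ?(mxE, mulmx3E) /=.
rewrite !sum_ord3 !mxE /= ?(mulr0n, mulr1n, mulr0, mul0r, addr0, add0r).
(* Row i and column i have the same norm, which makes the three differences of squares equal; their
   coefficients in [T] add up to 0. *)
have K1 : P 2 1 ^+ 2 - P 1 2 ^+ 2 = P 0 2 ^+ 2 - P 2 0 ^+ 2 by lra.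
have K2 : P 2 1 ^+ 2 - P 1 2 ^+ 2 = P 1 0 ^+ 2 - P 0 1 ^+ 2 by lra.
have S0 : m * (P 2 1 - P 1 2) ^+ 2 <=
  (g 0 2 + g 0 1) / 2 * (P 2 1 - P 1 2) ^+ 2.
  by apply: ler_wpM2r; [exact: sqr_ge0|lra].
have S1 : m * (P 0 2 - P 2 0) ^+ 2 <=
  (g 0 0 + g 0 2) / 2 * (P 0 2 - P 2 0) ^+ 2.
  by apply: ler_wpM2r; [exact: sqr_ge0|lra].
have S2 : m * (P 1 0 - P 0 1) ^+ 2 <=
  (g 0 1 + g 0 0) / 2 * (P 1 0 - P 0 1) ^+ 2.
  by apply: ler_wpM2r; [exact: sqr_ge0|lra].
have T : (g 0 2 - g 0 1) * (P 2 1 ^+ 2 - P 1 2 ^+ 2) +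
  (g 0 0 - g 0 2) * (P 0 2 ^+ 2 - P 2 0 ^+ 2) +
  (g 0 1 - g 0 0) * (P 1 0 ^+ 2 - P 0 1 ^+ 2) = 0 by rewrite -K1 -K2; ring.
lra.
Qed.

End Rotations.

(** * Quadratic forms *)

Section Quadratic.
Variable R : realType.

Lemma dotv_sum n (x y : 'cV[R]_n) : dotv x y = \sum_i x i 0 * y i 0.
Proof. by rewrite /dotv mxE; apply: eq_bigr => i _; rewrite mxE. Qed.

Lemma dotvv_sum n (x : 'cV[R]_n) : dotv x x = \sum_i x i 0 ^+ 2.
Proof. by rewrite dotv_sum; apply: eq_bigr => i _; rewrite expr2. Qed.

Lemma dotvv_ge0 n (x : 'cV[R]_n) : 0 <= dotv x x.
Proof. by rewrite dotvv_sum; apply: sumr_ge0 => i _; exact: sqr_ge0. Qed.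

Lemma coord_le_dotvv n (x : 'cV[R]_n) i : x i 0 ^+ 2 <= dotv x x.
Proof.
rewrite dotvv_sum (bigD1 i) //= lerDl; apply: sumr_ge0 => j _; exact: sqr_ge0.
Qed.

Lemma dotvC n (x y : 'cV[R]_n) : dotv x y = dotv y x.
Proof. by rewrite !dotv_sum; apply: eq_bigr => i _; rewrite mulrC. Qed.

Lemma dotvDl n (x y z : 'cV[R]_n) : dotv (x + y) z = dotv x z + dotv y z.
Proof. by rewrite /dotv linearD mulmxDl mxE. Qed.

Lemma dotvZl n a (x z : 'cV[R]_n) : dotv (a *: x) z = a * dotv x z.
Proof. by rewrite /dotv linearZ -scalemxAl mxE. Qed.

Lemma dotvDr n (x y z : 'cV[R]_n) : dotv z (x + y) = dotv z x + dotv z y.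
Proof. by rewrite dotvC dotvDl !(dotvC z). Qed.

Lemma dotvZr n a (x z : 'cV[R]_n) : dotv z (a *: x) = a * dotv z x.
Proof. by rewrite dotvC dotvZl dotvC. Qed.

Lemma dotvNr n (x z : 'cV[R]_n) : dotv z (- x) = - dotv z x.
Proof. by rewrite -scaleN1r dotvZr mulN1r. Qed.

Lemma dotv_young n (x y : 'cV[R]_n) a : 0 < a ->
  `|dotv x y| <= a / 2 * dotv x x + (2 * a)^-1 * dotv y y.
Proof.
move=> a0.
(* Taking [s] to be 1 or -1 covers both signs of the inner product. *)
have H s : s ^+ 2 = 1 ->
    s * dotv x y <= a / 2 * dotv x x + (2 * a)^-1 * dotv y y.
  move=> s1; have := dotvv_ge0 (a *: x - s *: y).
  rewrite -scaleNr !(dotvDl, dotvDr, dotvZl, dotvZr) (dotvC y) => w.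
  have -> : a / 2 * dotv x x + (2 * a)^-1 * dotv y y =
     (2 * a)^-1 * (a ^+ 2 * dotv x x + s ^+ 2 * dotv y y).
    by rewrite s1; field; rewrite gt_eqF.
  by rewrite mulrC ler_pdivlMl ?mulr_gt0 //; nra.
rewrite ler_norml lerNl -mulN1r -[X in _ && (X <= _)]mul1r !H ?expr1n //.
by rewrite sqrrN expr1n.
Qed.

Lemma mulmx_dotvv_le n (M : 'M[R]_n) : exists2 K, 0 < K &
  forall x : 'cV[R]_n, dotv (M *m x) (M *m x) <= K * dotv x x.
Proof.
(* Every row has l1 norm at most [C], so each of the [n] coordinates of [M *m x] is at most [C]
   times the Euclidean norm of [x]. The 1 added below makes the constant positive. *)
pose C := \sum_i \sum_j `|M i j|.
exists (n%:R * C ^+ 2 + 1).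
  by rewrite ltr_wpDl // mulr_ge0 // sqr_ge0.
move=> x; rewrite [leLHS]dotvv_sum.
have Ci i : \sum_j `|M i j| <= C.
  rewrite /C [leRHS](bigD1 i) //= lerDl; apply: sumr_ge0 => k _.
  exact: sumr_ge0.
apply: (@le_trans _ _ (\sum_(i < n) C ^+ 2 * dotv x x)); last first.
  rewrite sumr_const card_ord -[leLHS]mulr_natl mulrA.
  by rewrite ler_wpM2r ?dotvv_ge0 // lerDl.
apply: ler_sum => i _.
have s0 := dotvv_ge0 x.
rewrite -[X in _ * X]sqr_sqrtr // -exprMn -real_normK ?num_real //.
have C0 : 0 <= C by apply: sumr_ge0 => k _; exact: sumr_ge0.
rewrite ler_pXn2r ?nnegrE ?mulr_ge0 ?sqrtr_ge0 //.
rewrite mxE (le_trans (ler_norm_sum _ _ _)) //.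
apply: (@le_trans _ _ (\sum_j `|M i j| * Num.sqrt (dotv x x))).
  apply: ler_sum => j _; rewrite normrM ler_wpM2l // -sqrtr_sqr.
  exact/ler_wsqrtr/coord_le_dotvv.
by rewrite -mulr_suml ler_wpM2r ?sqrtr_ge0.
Qed.

Section Posdef.
Variables (n : nat) (J : 'M[R]_n).
Hypothesis J_posdef : posdefmx J.

Lemma posdef_ge0 (x : 'cV[R]_n) : 0 <= dotv x (J *m x).
Proof.
have [->|/(J_posdef.2)/ltW] := eqVneq x 0; last by rewrite /dotv mulmxA.
by rewrite mulmx0 /dotv mulmx0 mxE.
Qed.

Lemma posdef_dotvC (x y : 'cV[R]_n) : dotv x (J *m y) = dotv y (J *m x).
Proof. by rewrite dotvC /dotv trmx_mul J_posdef.1 mulmxA. Qed.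

Lemma posdef_unit : J \in unitmx.
Proof.
rewrite -row_free_unit; apply: inj_row_free => v vJ0.
apply/eqP; apply: contraT => v0; have := J_posdef.2 v^T.
by rewrite trmx_eq0 => /(_ v0); rewrite trmxK vJ0 mul0mx mxE ltxx.
Qed.

(* Cauchy-Schwarz for the inner product of J, between x and J^-1 e_i. *)
Lemma posdef_coord i : exists2 k, 0 < k &
  forall x : 'cV[R]_n, x i 0 ^+ 2 <= k * dotv x (J *m x).
Proof.
pose z : 'cV[R]_n := invmx J *m delta_mx i 0.
have Jz : J *m z = delta_mx i 0 by rewrite mulmxA mulmxV ?posdef_unit // mul1mx.
have z0 : z != 0.
  apply/eqP => z0; move: Jz; rewrite z0 mulmx0 => /matrixP/(_ i 0)/eqP.
  by rewrite !mxE !eqxx eq_sym oner_eq0.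
have xJz x : dotv x (J *m z) = x i 0.
  rewrite Jz dotv_sum (bigD1 i) //= big1 ?mxE ?eqxx ?mulr1 ?addr0 // => j ji.
  by rewrite mxE (negbTE ji) mulr0.
have k0 : 0 < dotv z (J *m z) by rewrite /dotv mulmxA J_posdef.2.
exists (dotv z (J *m z)) => // x; set k := dotv z _ in k0 *.
have := posdef_ge0 (k *: x - x i 0 *: z).
rewrite -scaleNr mulmxDr -!scalemxAr !(dotvDl, dotvDr, dotvZl, dotvZr).
by rewrite (posdef_dotvC z x) xJz -/k => w; rewrite -(ler_pM2l k0); nra.
Qed.

(** Adding up the coordinate bounds replaces the smallest eigenvalue of [J]. The 1 added to the sum
    makes the constant positive even for [n = 0]. *)
Lemma posdef_ge_dotvv : exists2 k, 0 < k &
  forall x : 'cV[R]_n, dotv x x <= k * dotv x (J *m x).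
Proof.
have kP i : exists k, 0 < k /\
    forall x : 'cV[R]_n, x i 0 ^+ 2 <= k * dotv x (J *m x).
  by have [k ? ?] := posdef_coord i; exists k.
have [k kE] := choice kP.
exists (\sum_i k i + 1).
  by rewrite ltr_wpDl // sumr_ge0 // => i _; exact/ltW/(kE i).1.
move=> x; rewrite dotvv_sum mulrDl mul1r ler_wpDr ?posdef_ge0 // mulr_suml.
by apply: ler_sum => i _; exact: (kE i).2.
Qed.

End Posdef.

(** On matrices [|x|] is the maximum norm. This lemma and the next pass between it and the Euclidean
    [dotv], losing a factor [n] in one direction. *)
Lemma cV_norm_lt n (x : 'cV[R]_n) e : 0 < e -> dotv x x < e ^+ 2 -> `|x| < e.
Proof.
move=> e0 xe; rewrite [ltLHS]/Num.norm /= mx_normrE.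
apply/bigmax_ltP; split=> //.
move=> [i j] _ /=; rewrite (ord1 j) -(ltr_pXn2r (n := 2)) ?nnegrE ?(ltW e0) //.
by rewrite real_normK ?num_real // (le_lt_trans (coord_le_dotvv _ _)).
Qed.

Lemma dotvv_le_norm n (x : 'cV[R]_n) : dotv x x <= n%:R * `|x| ^+ 2.
Proof.
rewrite dotvv_sum.
apply: (@le_trans _ _ (\sum_(i < n) `|x| ^+ 2)); last first.
  by rewrite sumr_const card_ord mulr_natl.
apply: ler_sum => i _; rewrite -real_normK ?num_real //.
rewrite ler_pXn2r ?nnegrE //.
rewrite [leRHS]/Num.norm /= mx_normrE; apply/bigmax_geP; right.
by exists (i, 0).
Qed.

End Quadratic.

(** * Estimates on the attitude errors *)

Section ErrorEstimates.
Variables (R : realType) (Rd : 'M[R]_3) (r v : 'cV[R]_3) (theta alpha : R).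
Implicit Types (Q P : 'M[R]_3) (g : 'rV[R]_3).

Lemma errA_diag g Q : errA (diag_mx g) Rd Q =
  2^-1 * (g 0 0 * (1 - (Rd^T *m Q) 0 0) + g 0 1 * (1 - (Rd^T *m Q) 1 1) +
          g 0 2 * (1 - (Rd^T *m Q) 2 2)).
Proof.
rewrite /errA mxtrace3 !(mulmx3E (diag_mx g)) !mxE /=.
by rewrite ?(mulr0n, mulr1n, mul0r, addr0, add0r).
Qed.

Lemma eRA_trmx_mul g Q : eRA (diag_mx g) Rd Q =
  2^-1 *: vee (diag_mx g *m (Rd^T *m Q) - (Rd^T *m Q)^T *m diag_mx g).
Proof. by rewrite /eRA trmx_mul trmxK mulmxA. Qed.

Lemma pointing_dotv Q : pointing r v Q = dotv (Q *m r) v.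
Proof. by rewrite /pointing /dotv trmx_mul. Qed.

Hypotheses (r_unit : unit_vector r) (v_unit : unit_vector v).

Lemma pointing_ge Q : SO3 Q -> -1 <= pointing r v Q.
Proof.
move=> SQ; have rr : dotv (Q *m r) (Q *m r) = 1.
  by rewrite /dotv trmx_mul mulmxA -(mulmxA r^T) SO3_mulTmx // mulmx1.
have := dotvv_ge0 (Q *m r + v).
rewrite pointing_dotv !(dotvDl, dotvDr) (dotvC v) rr.
have -> : dotv v v = 1 by []; lra.
Qed.

Hypotheses (cos_ge0 : 0 <= cos theta) (alpha_gt0 : 0 < alpha).

(** Unit vectors have inner product at least -1, so the denominator [1 + cos theta] keeps the
    argument of [ln] at most 1. *)
Lemma errB_ge1 Q : SO3 Q -> pointing r v Q < cos theta ->
  1 <= errB r v theta alpha Q.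
Proof.
move=> SQ pc; rewrite /errB lerDl oppr_ge0.
have p1 := pointing_ge SQ.
rewrite mulr_ge0_le0 ?invr_ge0 ?(ltW alpha_gt0) // ln_le0 //.
by rewrite ler_pdivrMr; lra.
Qed.

Variables (g : 'rV[R]_3) (m M : R).
Hypotheses (m_gt0 : 0 < m) (g_ge : forall i, m <= g 0 i)
  (g_le : forall i, g 0 i <= M) (Rd_SO3 : SO3 Rd).

Local Notation xi Q := (axis (Rd^T *m Q)).

Lemma errA_ge Q : SO3 Q ->
  m / 2 * (3 - \tr (Rd^T *m Q)) <= errA (diag_mx g) Rd Q.
Proof.
move=> SQ; have SP := SO3_trmx_mul Rd_SO3 SQ.
rewrite errA_diag mxtrace3.
have E i : m * (1 - (Rd^T *m Q) i i) <= g 0 i * (1 - (Rd^T *m Q) i i).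
  by rewrite ler_wpM2r // subr_ge0 SO3_diag_le1.
by have := (E 0, E 1, E 2) => -[[E0 E1] E2]; lra.
Qed.

Lemma errA_le Q : SO3 Q ->
  errA (diag_mx g) Rd Q <= M / 2 * (3 - \tr (Rd^T *m Q)).
Proof.
move=> SQ; have SP := SO3_trmx_mul Rd_SO3 SQ.
rewrite errA_diag mxtrace3.
have E i : g 0 i * (1 - (Rd^T *m Q) i i) <= M * (1 - (Rd^T *m Q) i i).
  by rewrite ler_wpM2r // subr_ge0 SO3_diag_le1.
by have := (E 0, E 1, E 2) => -[[E0 E1] E2]; lra.
Qed.

Lemma SO3_trace_le Q : SO3 Q -> \tr (Rd^T *m Q) <= 3.
Proof.
move=> SQ; have D := @SO3_diag_le1 _ (Rd^T *m Q) _ (SO3_trmx_mul Rd_SO3 SQ).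
by have := (D 0, D 1, D 2) => -[[D0 D1] D2]; rewrite mxtrace3; lra.
Qed.

Lemma errA_ge0 Q : SO3 Q -> 0 <= errA (diag_mx g) Rd Q.
Proof.
move=> SQ; apply: le_trans (errA_ge SQ).
by rewrite mulr_ge0 ?subr_ge0 ?SO3_trace_le // divr_ge0 // ltW.
Qed.

Lemma dist_sqr_le_errA Q i j : SO3 Q ->
  (Rd i j - Q i j) ^+ 2 <= 4 / m * errA (diag_mx g) Rd Q.
Proof.
move=> SQ; have := SO3_dist_sqr Rd_SO3 SQ.
rewrite (bigD1 i) //= (bigD1 j) //= => E.
have A := errA_ge SQ.
have S1 : 0 <= \sum_(j0 < 3 | j0 != j) (Rd i j0 - Q i j0) ^+ 2.
  by apply: sumr_ge0 => k _; exact: sqr_ge0.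
have S2 : 0 <= \sum_(i0 < 3 | i0 != i) \sum_j0 (Rd i0 j0 - Q i0 j0) ^+ 2.
  by apply: sumr_ge0 => k _; apply: sumr_ge0 => l _; exact: sqr_ge0.
rewrite mulrAC ler_pdivlMr //.
apply: le_trans (_ : 2 * (3 - \tr (Rd^T *m Q)) * m <= _); last by lra.
by rewrite ler_wpM2r ?(ltW m_gt0) // -E -addrA lerDl addr_ge0.
Qed.

Lemma errA_eq0 Q : SO3 Q -> errA (diag_mx g) Rd Q = 0 -> Q = Rd.
Proof.
move=> SQ A0; apply/matrixP => i j.
have := dist_sqr_le_errA i j SQ; rewrite A0 mulr0 => D.
have : (Rd i j - Q i j) ^+ 2 == 0 by rewrite eq_le D sqr_ge0.
by rewrite sqrf_eq0 subr_eq0 => /eqP.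
Qed.

Lemma errA_gt0 Q : SO3 Q -> Q != Rd -> 0 < errA (diag_mx g) Rd Q.
Proof.
move=> SQ QRd; rewrite lt0r errA_ge0 // andbT.
by apply: contra QRd => /eqP/(errA_eq0 SQ)->.
Qed.

(** Sublevel sets of [errA] on SO(3) shrink to [Rd]. Every passage from a small energy to an
    attitude close to [Rd] goes through this. *)
Lemma near_errA_lt (D : set 'M[R]_3) : (\forall Q \near Rd, D Q) ->
  exists2 a, 0 < a & forall Q, SO3 Q -> errA (diag_mx g) Rd Q < a -> D Q.
Proof.
move=> /nbhs_ballP[e /= e0 De]; exists (m / 4 * e ^+ 2).
  by rewrite mulr_gt0 ?exprn_gt0 ?divr_gt0.
move=> Q SQ Aa; apply: De; split=> // i j.
rewrite -ball_normE /ball_ /= -(ltr_pXn2r (n := 2)) ?nnegrE ?(ltW e0) //.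
rewrite real_normK ?num_real // (le_lt_trans (dist_sqr_le_errA i j SQ)) //.
have -> : e ^+ 2 = 4 / m * (m / 4 * e ^+ 2) by field; rewrite gt_eqF.
by rewrite ltr_pM2l ?divr_gt0.
Qed.

(** The trace condition limits the angle of [Rd^T *m Q] to 90 degrees. Then [1 + \tr] is at least 2
    in [SO3_axis_sqr], whereas at 180 degrees the axis vanishes and [errA] does not. *)
Lemma errA_le_axis Q : SO3 Q -> 1 <= \tr (Rd^T *m Q) ->
  errA (diag_mx g) Rd Q <= M * dotv (xi Q) (xi Q).
Proof.
move=> SQ t1; have SP := SO3_trmx_mul Rd_SO3 SQ.
have E := SO3_axis_sqr SP; have A := errA_le SQ; have t3 := SO3_trace_le SQ.
apply: le_trans A _.
have M0 : 0 < M.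
  by apply: lt_le_trans m_gt0 _; exact: le_trans (g_ge 0) (g_le 0).
rewrite -mulrA ler_pM2l //; nra.
Qed.

Lemma axis_eR_ge Q : SO3 Q -> pointing r v Q < cos theta ->
  1 <= \tr (Rd^T *m Q) ->
  M * `|dotv (xi Q) (eRB r v theta alpha Q)| <= m / 2 ->
  m / 2 * dotv (xi Q) (xi Q) <=
    dotv (xi Q) (eR (diag_mx g) Rd r v theta alpha Q).
Proof.
move=> SQ pc t1 small; have SP := SO3_trmx_mul Rd_SO3 SQ.
have B1 := errB_ge1 SQ pc; have A0 := errA_ge0 SQ.
have AM := errA_le_axis SQ t1.
have H := SO3_axis_eRA SP g_ge; rewrite -eRA_trmx_mul in H.
have x0 := dotvv_ge0 (xi Q).
rewrite /eR dotvDr (dotvZr (errB _ _ _ _ _)) (dotvZr (errA _ _ _)).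
set X := dotv (xi Q) (xi Q) in H AM x0 *; set a := dotv _ (eRA _ _ _) in H *.
set b := dotv _ (eRB _ _ _ _ _) in small *.
have mX : 0 <= m * X by rewrite mulr_ge0 // ltW.
(* The factor [errB >= 1] can only help, because [a] is nonnegative. The other term costs at most
   half of this bound, by [small] and [errA <= M * X]. *)
have Ba : m * X <= errB r v theta alpha Q * a.
  apply: (le_trans H); apply: ler_peMl => //; exact: le_trans mX H.
have Ab : - (errA (diag_mx g) Rd Q * b) <= m / 2 * X.
  apply: (@le_trans _ _ (M * X * `|b|)).
    rewrite -mulrN (le_trans (_ : _ <= errA (diag_mx g) Rd Q * `|b|)) //.
      by rewrite ler_wpM2l // -normrN ler_norm.
    by rewrite ler_wpM2r.
  by rewrite mulrAC ler_wpM2r.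
lra.
Qed.

End ErrorEstimates.

(** * Limits and derivatives of matrix-valued functions *)

Section MatrixLimits.
Variables (R : realType) (T : Type) (F : set_system T).
Context {FF : Filter F}.

Lemma cvg_mx_coord m n (f : T -> 'M[R]_(m, n)) (A : 'M[R]_(m, n)) i j :
  f x @[x --> F] --> A -> f x i j @[x --> F] --> A i j.
Proof.
move=> fA.
apply: (@continuous_cvg _ _ _ _ _ _ (fun M : 'M[R]_(m, n) => M i j)) fA.
exact: coord_continuous.
Qed.

Lemma cvg_mx m n (f : T -> 'M[R]_(m, n)) (A : 'M[R]_(m, n)) :
  (forall i j, f x i j @[x --> F] --> A i j) -> f x @[x --> F] --> A.
Proof.
move=> fA; apply/cvg_ballP => e e0.
have H : \forall x \near F, forall ij : 'I_m * 'I_n,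
    ball (A ij.1 ij.2) e (f x ij.1 ij.2).
  apply: (@filter_forall _ _ (fun ij x => ball (A ij.1 ij.2) e (f x ij.1 ij.2))).
  by move=> ij; have /cvg_ballP := fA ij.1 ij.2; exact.
by apply: filterS H => x H; split=> // i j; exact: (H (i, j)).
Qed.

Lemma cvg_mulmx m n p (f : T -> 'M[R]_(m, n)) (g : T -> 'M[R]_(n, p))
    (A : 'M[R]_(m, n)) (B : 'M[R]_(n, p)) :
  f x @[x --> F] --> A -> g x @[x --> F] --> B ->
  f x *m g x @[x --> F] --> A *m B.
Proof.
move=> fA gB; apply: cvg_mx => i j; rewrite mxE.
under eq_fun do rewrite mxE.
apply: cvg_big => [|k _]; first exact: add_continuous.
by apply: cvgM; exact: cvg_mx_coord.
Qed.

Lemma cvg_trmx m n (f : T -> 'M[R]_(m, n)) (A : 'M[R]_(m, n)) :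
  f x @[x --> F] --> A -> (f x)^T @[x --> F] --> A^T.
Proof.
move=> fA; apply: cvg_mx => i j; rewrite mxE.
by under eq_fun do rewrite mxE; exact: cvg_mx_coord.
Qed.

Lemma cvg_mxtrace n (f : T -> 'M[R]_n) (A : 'M[R]_n) :
  f x @[x --> F] --> A -> \tr (f x) @[x --> F] --> \tr A.
Proof.
move=> fA; apply: cvg_big => [|k _]; first exact: add_continuous.
exact: cvg_mx_coord.
Qed.

Lemma cvg_vee (f : T -> 'M[R]_3) (A : 'M[R]_3) :
  f x @[x --> F] --> A -> vee (f x) @[x --> F] --> vee A.
Proof.
move=> fA; apply: cvg_mx => i j; rewrite mxE.
under eq_fun do rewrite mxE.
by elim/ord3P: i => /=; exact: cvg_mx_coord.
Qed.

Lemma cvg_hat (f : T -> 'cV[R]_3) (A : 'cV[R]_3) :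
  f x @[x --> F] --> A -> hat (f x) @[x --> F] --> hat A.
Proof.
move=> fA; apply: cvg_mx => i j; rewrite mxE.
under eq_fun do rewrite mxE.
elim/ord3P: i; elim/ord3P: j => /=; try exact: cvg_cst;
  try (exact: cvg_mx_coord); by apply: cvgN; exact: cvg_mx_coord.
Qed.

Lemma cvg_dotv n (f g : T -> 'cV[R]_n) (A B : 'cV[R]_n) :
  f x @[x --> F] --> A -> g x @[x --> F] --> B ->
  dotv (f x) (g x) @[x --> F] --> dotv A B.
Proof.
by move=> fA gB; apply: cvg_mx_coord; apply: cvg_mulmx => //; exact: cvg_trmx.
Qed.

Lemma cvg_axis (f : T -> 'M[R]_3) (A : 'M[R]_3) :
  f x @[x --> F] --> A -> axis (f x) @[x --> F] --> axis A.
Proof.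
move=> fA; apply: cvgZ; first exact: cvg_cst.
by apply: cvg_vee; apply: cvgB => //; exact: cvg_trmx.
Qed.

Section Errors.
Variables (G Rd : 'M[R]_3) (r v : 'cV[R]_3) (theta alpha : R).
Variables (f : T -> 'M[R]_3) (Q : 'M[R]_3).
Hypothesis fQ : f x @[x --> F] --> Q.

Lemma cvg_pointing : pointing r v (f x) @[x --> F] --> pointing r v Q.
Proof.
apply: cvg_mx_coord; apply: cvg_mulmx; last exact: cvg_cst.
by apply: cvg_mulmx; [exact: cvg_cst|exact: cvg_trmx].
Qed.

Lemma cvg_errA : errA G Rd (f x) @[x --> F] --> errA G Rd Q.
Proof.
apply: cvgM; first exact: cvg_cst.
apply: cvg_mxtrace; apply: cvg_mulmx; first exact: cvg_cst.
by apply: cvgB; [exact: cvg_cst|apply: cvg_mulmx => //; exact: cvg_cst].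
Qed.

Lemma cvg_eRA : eRA G Rd (f x) @[x --> F] --> eRA G Rd Q.
Proof.
apply: cvgZ; first exact: cvg_cst.
apply: cvg_vee; apply: cvgB; apply: cvg_mulmx => //; try exact: cvg_cst.
by apply: cvg_mulmx; [exact: cvg_trmx|exact: cvg_cst].
Qed.

Hypotheses (alpha_gt0 : 0 < alpha) (cos_ge0 : 0 <= cos theta)
  (Q_free : pointing r v Q < cos theta).

Lemma cvg_errB :
  errB r v theta alpha (f x) @[x --> F] --> errB r v theta alpha Q.
Proof.
apply: cvgB; first exact: cvg_cst.
apply: cvgM; first exact: cvg_cst.
apply: (@continuous_cvg _ _ _ _ _ _ (@ln R)).
  by apply: continuous_ln; rewrite divr_gt0 ?subr_gt0 // ltr_wpDr.
apply: cvgM; last exact: cvg_cst.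
by apply: cvgB; [exact: cvg_cst|exact: cvg_pointing].
Qed.

Lemma cvg_eRB : eRB r v theta alpha (f x) @[x --> F] --> eRB r v theta alpha Q.
Proof.
apply: cvgZ.
  apply: cvgV.
    by apply: mulf_neq0; [rewrite gt_eqF|rewrite lt_eqF // subr_lt0].
  apply: cvgM; first exact: cvg_cst.
  by apply: cvgB; [exact: cvg_pointing|exact: cvg_cst].
apply: cvg_mulmx; last exact: cvg_cst.
apply: cvg_hat; apply: cvg_mulmx; last exact: cvg_cst.
exact: cvg_trmx.
Qed.

Lemma cvg_eR : eR G Rd r v theta alpha (f x) @[x --> F] -->
  eR G Rd r v theta alpha Q.
Proof.
apply: cvgD; apply: cvgZ; [exact: cvg_errB|exact: cvg_eRA|exact: cvg_errA|].
exact: cvg_eRB.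
Qed.

End Errors.
End MatrixLimits.

Section MatrixDerivatives.
Variables (R : realType).

Lemma is_derive_mxP m n (M : R -> 'M[R]_(m, n)) (t : R)
    (D : 'M[R]_(m, n)) :
  is_derive t 1 M D <->
  forall i j, is_derive t 1 (fun s => M s i j) (D i j).
Proof.
split=> [[dM DM] i j|H].
  split; first by move/derivable_mxP : dM; apply.
  by rewrite -DM derive_mx // mxE.
have dM : derivable M t 1 by apply/derivable_mxP => i j; case: (H i j).
split=> //; rewrite derive_mx //.
by apply/matrixP => i j; rewrite mxE derive_val.
Qed.

Lemma is_derive_mulmx m n p (M : R -> 'M[R]_(m, n)) (N : R -> 'M[R]_(n, p))
    (t : R) (DM : 'M[R]_(m, n)) (DN : 'M[R]_(n, p)) :
  is_derive t 1 M DM -> is_derive t 1 N DN ->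
  is_derive t 1 (fun s => M s *m N s) (DM *m N t + M t *m DN).
Proof.
move=> /is_derive_mxP dM /is_derive_mxP dN; apply/is_derive_mxP => i j.
rewrite [X in is_derive _ _ X](_ : _ =
    \sum_k ((fun s => M s i k) * (fun s => N s k j))); last first.
  by apply/funext => s; rewrite mxE fct_sumE.
rewrite [X in is_derive _ _ _ X](_ : _ =
    \sum_k (M t i k *: DN k j + N t k j *: DM i k)); last first.
  rewrite !mxE -big_split; apply: eq_bigr => k _ /=.
  by rewrite /GRing.scale /= addrC [N t k j * _]mulrC.
by apply: is_derive_sum => k; exact: is_deriveM.
Qed.

Lemma is_derive_mulmxr m n p (A : 'M[R]_(m, n)) (N : R -> 'M[R]_(n, p))
    (t : R) (DN : 'M[R]_(n, p)) :
  is_derive t 1 N DN -> is_derive t 1 (fun s => A *m N s) (A *m DN).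
Proof.
move=> dN; have := is_derive_mulmx (is_derive_cst A t 1) dN.
by rewrite mul0mx add0r.
Qed.

Lemma is_derive_mulmxl m n p (M : R -> 'M[R]_(m, n)) (A : 'M[R]_(n, p))
    (t : R) (DM : 'M[R]_(m, n)) :
  is_derive t 1 M DM -> is_derive t 1 (fun s => M s *m A) (DM *m A).
Proof.
move=> dM; have := is_derive_mulmx dM (is_derive_cst A t 1).
by rewrite mulmx0 addr0.
Qed.

Lemma is_derive_trmx m n (M : R -> 'M[R]_(m, n)) (t : R) (DM : 'M[R]_(m, n)) :
  is_derive t 1 M DM -> is_derive t 1 (fun s => (M s)^T) DM^T.
Proof.
move=> /is_derive_mxP dM; apply/is_derive_mxP => i j; rewrite mxE.
by under eq_fun do rewrite mxE.
Qed.

Lemma is_derive_mxtrace n (M : R -> 'M[R]_n) (t : R) (DM : 'M[R]_n) :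
  is_derive t 1 M DM -> is_derive t 1 (fun s => \tr (M s)) (\tr DM).
Proof.
move=> /is_derive_mxP dM.
rewrite [X in is_derive _ _ X](_ : _ = \sum_k (fun s => M s k k)).
  exact: is_derive_sum.
by apply/funext => s; rewrite fct_sumE.
Qed.

Lemma is_derive_vee (M : R -> 'M[R]_3) (t : R) (DM : 'M[R]_3) :
  is_derive t 1 M DM -> is_derive t 1 (fun s => vee (M s)) (vee DM).
Proof.
move=> /is_derive_mxP dM; apply/is_derive_mxP => i j; rewrite mxE.
under eq_fun do rewrite mxE.
by elim/ord3P: i => /=.
Qed.

Lemma is_derive_axis (M : R -> 'M[R]_3) (t : R) (DM : 'M[R]_3) :
  is_derive t 1 M DM -> is_derive t 1 (fun s => axis (M s)) (axis DM).
Proof.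
move=> dM; apply: (is_deriveZ (f := fun s => vee (M s - (M s)^T))).
apply: is_derive_vee; apply: is_deriveB => //; exact: is_derive_trmx.
Qed.

Lemma is_derive_dotv n (x y : R -> 'cV[R]_n) (t : R) (dx dy : 'cV[R]_n) :
  is_derive t 1 x dx -> is_derive t 1 y dy ->
  is_derive t 1 (fun s => dotv (x s) (y s)) (dotv dx (y t) + dotv (x t) dy).
Proof.
move=> dx_ dy_; have := is_derive_mulmx (is_derive_trmx dx_) dy_.
by move=> /is_derive_mxP/(_ 0 0); rewrite mxE.
Qed.

End MatrixDerivatives.

(** * Gradients of the attitude errors along the kinematics *)

Section ErrorDerivatives.
Variables (R : realType) (G Rd : 'M[R]_3) (r v : 'cV[R]_3) (theta alpha : R).
Hypothesis G_sym : G^T = G.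
Implicit Types (w : 'cV[R]_3) (Q : R -> 'M[R]_3).

(** The trace pairing with a skew-symmetric matrix only sees the skew part of [M]. This is where the
    [vee] in [eRA] comes from. *)
Lemma trace_mul_hat (M : 'M[R]_3) w :
  \tr (M *m hat w) = - dotv (vee (M - M^T)) w.
Proof.
rewrite mxtrace3 !mulmx3E dotvE !mxE /= ?mxE; ring.
Qed.

Lemma dotv_hat_rot (x y z : 'cV[R]_3) :
  dotv (hat x *m y) z = - dotv (hat z *m y) x.
Proof. by rewrite !dotvE !mulmx3E !mxE /=; ring. Qed.

(** The squared norm of the axis is half the squared Frobenius norm of the skew part, hence at most
    half that of [P *m hat w], which equals that of [hat w], namely [2 * dotv w w]. This bounds the
    speed of xi by that of the rotation. *)
Lemma SO3_axis_mul_hat (P : 'M[R]_3) w : SO3 P ->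
  dotv (axis (P *m hat w)) (axis (P *m hat w)) <= dotv w w.
Proof.
move=> SP; have [A0 A1 A2] := axisE (P *m hat w).
rewrite [leLHS]dotvE A0 A1 A2; set D := P *m hat w.
have : \tr (D^T *m D) = 2 * dotv w w.
  rewrite /D trmx_mul mulmxA -(mulmxA _ P^T) SO3_mulTmx // mulmx1.
  by rewrite mxtrace3 !mulmx3E dotvE !mxE /=; ring.
move: D => D; rewrite mxtrace3 !mulmx3E ![D^T _ _]mxE => trD.
have := (sqr_ge0 (D 2 1 + D 1 2), sqr_ge0 (D 0 2 + D 2 0),
  sqr_ge0 (D 1 0 + D 0 1)) => -[[S0 S1] S2].
have := (sqr_ge0 (D 0 0), sqr_ge0 (D 1 1), sqr_ge0 (D 2 2)) => -[[T0 T1] T2].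
have := (sqr_ge0 (D 2 1 - D 1 2), sqr_ge0 (D 0 2 - D 2 0),
  sqr_ge0 (D 1 0 - D 0 1)) => -[[U0 U1] U2].
lra.
Qed.

Section Path.
Variables (Q : R -> 'M[R]_3) (w : 'cV[R]_3) (t : R).
Hypothesis dQ : is_derive t 1 Q (Q t *m hat w).

Lemma is_derive_errA :
  is_derive t 1 (fun s => errA G Rd (Q s)) (dotv (eRA G Rd (Q t)) w).
Proof.
have d := is_derive_mxtrace (is_derive_mulmxr G
  (is_deriveB (is_derive_cst (1%:M : 'M[R]_3) t 1) (is_derive_mulmxr Rd^T dQ))).
apply: is_derive_eq (is_deriveZ 2^-1 d) _.
rewrite sub0r mulmxN !mulmxA linearN /= trace_mul_hat opprK /GRing.scale /=.
by rewrite /eRA dotvZl !trmx_mul trmxK G_sym !mulmxA.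
Qed.

Lemma is_derive_pointing :
  is_derive t 1 (fun s => pointing r v (Q s))
    (- dotv (hat ((Q t)^T *m v) *m r) w).
Proof.
have d := is_derive_mulmxl v (is_derive_mulmxr r^T (is_derive_trmx dQ)).
have /is_derive_mxP/(_ 0 0) := d; move/is_derive_eq; apply.
by rewrite -dotv_hat_rot /dotv !trmx_mul !mulmxA.
Qed.

Lemma is_derive_errB : 0 <= cos theta -> 0 < alpha ->
  pointing r v (Q t) < cos theta ->
  is_derive t 1 (fun s => errB r v theta alpha (Q s))
    (dotv (eRB r v theta alpha (Q t)) w).
Proof.
move=> cos_ge0 alpha_gt0 pc.
have c1 : 0 < 1 + cos theta by rewrite ltr_wpDr.
have y0 : 0 < (cos theta - pointing r v (Q t)) / (1 + cos theta).
  by rewrite divr_gt0 // subr_gt0.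
have dy : is_derive t 1
    (fun s => (cos theta - pointing r v (Q s)) / (1 + cos theta))
    (dotv (hat ((Q t)^T *m v) *m r) w / (1 + cos theta)).
  rewrite [X in is_derive _ _ X](_ : _ = (1 + cos theta)^-1 \*:
      (cst (cos theta) - (fun s => pointing r v (Q s)))); last first.
    by apply/funext => s; rewrite /= mulrC.
  apply: is_derive_eq (is_deriveZ _ (is_deriveB (is_derive_cst _ _ _)
    is_derive_pointing)) _.
  by rewrite sub0r opprK mulrC.
have dl := is_derive1_comp
  (g := fun s => (cos theta - pointing r v (Q s)) / (1 + cos theta))
  (is_derive1_ln y0) dy.
have := is_deriveB (is_derive_cst (1 : R) t 1) (is_deriveZ alpha^-1 dl).
move/is_derive_eq; apply.
rewrite sub0r dotvZl /GRing.scale /=; field.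
have n1 : cos theta - pointing r v (Q t) != 0 by rewrite gt_eqF ?subr_gt0.
have n2 : pointing r v (Q t) - cos theta != 0 by rewrite lt_eqF ?subr_lt0.
by rewrite n1 n2 !gt_eqF.
Qed.

Lemma is_derive_errAB : 0 <= cos theta -> 0 < alpha ->
  pointing r v (Q t) < cos theta ->
  is_derive t 1 (fun s => errA G Rd (Q s) * errB r v theta alpha (Q s))
    (dotv (eR G Rd r v theta alpha (Q t)) w).
Proof.
move=> c0 a0 pc; have := is_deriveM is_derive_errA (is_derive_errB c0 a0 pc).
move/is_derive_eq; apply.
by rewrite /eR dotvDl (dotvZl (errB _ _ _ _ _)) (dotvZl (errA _ _ _)) addrC.
Qed.

End Path.

Lemma is_derive_kinetic (J : 'M[R]_3) (Om : R -> 'cV[R]_3) (t : R)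
    (dOm : 'cV[R]_3) :
  J^T = J -> is_derive t 1 Om dOm ->
  is_derive t 1 (fun s => 2^-1 * dotv (Om s) (J *m Om s))
    (dotv (Om t) (J *m dOm)).
Proof.
move=> JT dOm_; have d := is_derive_dotv dOm_ (is_derive_mulmxr J dOm_).
apply: is_derive_eq (is_deriveZ 2^-1 d) _.
have -> : dotv dOm (J *m Om t) = dotv (Om t) (J *m dOm).
  by rewrite dotvC /dotv trmx_mul JT mulmxA.
by rewrite /GRing.scale /=; field.
Qed.

End ErrorDerivatives.

(** * Trajectories *)

Section Horizon.
Variable R : realType.
Implicit Types (T : \bar R) (s t a b : R).

Lemma horizonW T s t : horizon T t -> 0 <= s -> s <= t -> horizon T s.
Proof.
by move=> [_ tT] s0 st; split=> //; apply: le_lt_trans tT; rewrite lee_fin.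
Qed.

Lemma prod_norm_lt (U V : normedModType R) (x : U * V) e :
  `|x| < e = (`|x.1| < e) && (`|x.2| < e).
Proof. by rewrite [in LHS]/Num.norm /= gt_max. Qed.

(** The derivative is required only inside the interval, which allows [a = 0], where a trajectory is
    merely continuous from the right. Continuity of [phi] is required only at the points visited,
    since the energy is well behaved only where the constraint is strict. *)
Lemma increment_le (X : topologicalType) (T : \bar R) (x : R -> X)
    (phi : X -> R) (dphi : R -> R) (a b k : R) :
  {within horizon T, continuous x} -> 0 <= a -> a <= b -> horizon T b ->
  (forall t, a <= t <= b -> {for x t, continuous phi}) ->
  (forall t, a < t < b ->
     is_derive t 1 (fun s => phi (x s)) (dphi t) /\ dphi t <= k) ->
  phi (x b) - phi (x a) <= k * (b - a).
Proof.
move=> xcont a0; rewrite le_eqVlt => /predU1P[-> _ _ _|ab Tb phic dphiP].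
  by rewrite !subrr mulr0.
have [||c cab ->] := @MVT R (fun s => phi (x s)) dphi a b ab.
- by move=> t; rewrite in_itv /= => /dphiP[].
- have sub : `[a, b]%classic `<=` horizon T.
    move=> t /=; rewrite in_itv /= => /andP[at_ tb].
    by apply: horizonW Tb _ tb; exact: le_trans at_.
  have := continuous_subspaceW sub xcont.
  move=> /subspace_continuousP H; apply/subspace_continuousP => t tab.
  apply: (@continuous_cvg _ _ _ _ _ x phi); last exact: H.
  by apply: phic; move: tab; rewrite /= in_itv.
- rewrite ler_wpM2r ?subr_ge0 ?(ltW ab) //; apply: (dphiP c _).2.
  by move: cab; rewrite in_itv.
Qed.

Lemma first_exit (T : \bar R) (f : R -> R) c t1 :
  {within horizon T, continuous f} -> f 0 < c -> horizon T t1 -> c <= f t1 ->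
  exists t, [/\ 0 < t, t <= t1, c <= f t & forall s, 0 <= s < t -> f s < c].
Proof.
move=> /subspace_continuousP fc f0 Tt1 ft1.
pose S := [set s | 0 <= s <= t1 /\ c <= f s].
have S1 : S t1 by split=> //; rewrite lexx (Tt1.1).
have lbS : lbound S 0 by move=> s [/andP[]].
have infS : has_inf S by split; [exists t1|exists 0].
have i0 : 0 <= inf S by apply: lb_le_inf => //; exists t1.
have i1 : inf S <= t1 by apply: ge_inf => //; exists 0.
(* Otherwise [f] would stay below [c] for a while after [inf S], although [S] has points arbitrarily
   close to its infimum. *)
have ci : c <= f (inf S).
  rewrite leNgt; apply/negP => fi.
  have Ti := horizonW Tt1 i0 i1.
  have /nbhs_ballP[e /= e0 He] :
      within (horizon T) (nbhs (inf S)) [set s | f s < c].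
    exact: cvgr_lt (fc _ Ti) _ fi.
  have [s Ss se] := inf_adherent e0 infS.
  have is_ : inf S <= s by apply: ge_inf => //; exists 0.
  have [/andP[s0 s1] cs] := Ss.
  have := He s; rewrite /= -ball_normE /ball_ /= distrC ger0_norm ?subr_ge0 //.
  rewrite ltrBlDl => /(_ se (horizonW Tt1 s0 s1)).
  by rewrite ltNge cs.
exists (inf S); split=> //.
  by rewrite lt_neqAle i0 andbT; apply: contraTneq ci => <-; rewrite -ltNge.
move=> s /andP[s0 si]; rewrite ltNge; apply/negP => cs.
have : inf S <= s.
  apply: ge_inf; first by exists 0.
  by split=> //; rewrite s0 (le_trans (ltW si)).
by rewrite leNgt si.
Qed.

End Horizon.

(** * The closed loop *)

Section ClosedLoop.
Variables (R : realType) (J : 'M[R]_3) (r v : 'cV[R]_3) (theta alpha : R).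
Variables (g : 'rV[R]_3) (m M : R) (Rd : 'M[R]_3) (kR kOmega : R).
Hypotheses (J_posdef : posdefmx J)
  (r_unit : unit_vector r) (v_unit : unit_vector v)
  (cos_ge0 : 0 <= cos theta) (alpha_gt0 : 0 < alpha)
  (m_gt0 : 0 < m) (g_ge : forall i, m <= g 0 i) (g_le : forall i, g 0 i <= M)
  (Rd_SO3 : SO3 Rd) (Rd_constraint : pointing r v Rd < cos theta)
  (kR_gt0 : 0 < kR) (kOmega_gt0 : 0 < kOmega).

Implicit Types (T : \bar R) (x : R -> 'M[R]_3 * 'cV[R]_3) (Q : 'M[R]_3).
Implicit Types (y : 'M[R]_3 * 'cV[R]_3) (t : R).

Local Notation A := (errA (diag_mx g) Rd).
Local Notation B := (errB r v theta alpha).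
Local Notation e := (eR (diag_mx g) Rd r v theta alpha).
Local Notation p := (pointing r v).
Local Notation xi Q := (axis (Rd^T *m Q)).
Local Notation loop := (rigid_body_trajectory J
  (control (diag_mx g) Rd r v theta alpha J kR kOmega)).

(** * Dissipation of the energy *)

Definition energy y : R := 2^-1 * dotv y.2 (J *m y.2) + kR * (A y.1 * B y.1).

Lemma M_gt0 : 0 < M.
Proof. by apply: lt_le_trans m_gt0 _; exact: le_trans (g_ge 0) (g_le 0). Qed.

Lemma loop_SO3 T x t : loop T x -> horizon T t -> SO3 (x t).1.
Proof. by case=> _ + _ _; apply. Qed.

(** The gyroscopic term of the control cancels that of the dynamics, which leaves a
    proportional-derivative feedback. *)
Lemma loop_derive T x t : loop T x -> horizon T t -> 0 < t ->
  exists dOm : 'cV[R]_3,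
  [/\ is_derive t 1 (fun s => (x s).1) ((x t).1 *m hat (x t).2),
      is_derive t 1 (fun s => (x s).2) dOm &
      J *m dOm = - (kR *: e (x t).1) - kOmega *: (x t).2].
Proof.
case=> _ _ _ H Tt t0; have [dQ dO JO RO] := H t Tt t0.
exists (derive1 (fun s => (x s).2) t); split.
- by split=> //; rewrite -derive1E.
- by split=> //; rewrite -derive1E.
- by move: JO; rewrite /control /eOmega => /addIr.
Qed.

Lemma continuous_energy y : p y.1 < cos theta -> {for y, continuous energy}.
Proof.
move=> pc.
have c1 : z.1 @[z --> y] --> y.1 by exact: cvg_fst.
have c2 : z.2 @[z --> y] --> y.2 by exact: cvg_snd.
apply: cvgD.
  apply: cvgM; first exact: cvg_cst.
  by apply: cvg_dotv => //; apply: cvg_mulmx => //; exact: cvg_cst.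
apply: cvgM; first exact: cvg_cst.
by apply: cvgM; [exact: cvg_errA|exact: cvg_errB].
Qed.

Lemma is_derive_energy T x t : loop T x -> horizon T t -> 0 < t ->
  p (x t).1 < cos theta ->
  is_derive t 1 (fun s => energy (x s)) (- (kOmega * dotv (x t).2 (x t).2)).
Proof.
move=> lx Tt t0 pc; have [dOm [dQ dO JO]] := loop_derive lx Tt t0.
have d1 := is_derive_kinetic J_posdef.1 dO.
have d2 := @is_derive_errAB _ _ Rd r v theta alpha (tr_diag_mx g) _ _ _ dQ
  cos_ge0 alpha_gt0 pc.
apply: is_derive_eq (is_deriveD d1 (is_deriveZ kR d2)) _.
rewrite JO dotvDr !dotvNr !dotvZr (dotvC (e _)) /GRing.scale /=; ring.
Qed.

Lemma energy_le T x a b : loop T x -> 0 <= a -> a <= b -> horizon T b ->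
  (forall t, a <= t <= b -> p (x t).1 < cos theta) ->
  energy (x b) <= energy (x a).
Proof.
move=> lx a0 ab Tb pc; rewrite -subr_le0 -(mul0r (b - a)).
have xc : {within horizon T, continuous x} by case: lx.
apply: (increment_le (dphi := fun t => - (kOmega * dotv (x t).2 (x t).2))
  xc a0 ab Tb) => t tab.
  exact/continuous_energy/pc.
have /andP[at_ tb] := tab; have t0 : 0 < t by exact: le_lt_trans at_.
split; last by rewrite oppr_le0 mulr_ge0 ?dotvv_ge0 // ltW.
apply: (is_derive_energy lx _ t0 _); last first.
  by apply: pc; rewrite (ltW at_) (ltW tb).
exact: horizonW Tb (ltW t0) (ltW tb).
Qed.

Lemma errA_le_energy y : SO3 y.1 -> p y.1 < cos theta ->
  kR * A y.1 <= energy y.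
Proof.
move=> Sy pc; rewrite -[leLHS]add0r lerD //.
  by rewrite mulr_ge0 ?posdef_ge0.
rewrite ler_pM2l // ler_peMr // ?(errA_ge0 m_gt0) //.
exact: errB_ge1.
Qed.

Lemma kinetic_le_energy y : SO3 y.1 -> p y.1 < cos theta ->
  dotv y.2 (J *m y.2) <= 2 * energy y.
Proof.
move=> Sy pc; rewrite /energy.
have AB : 0 <= kR * (A y.1 * B y.1).
  rewrite mulr_ge0 ?(ltW kR_gt0) // mulr_ge0 ?(errA_ge0 m_gt0) //.
  by apply: le_trans ler01 _; exact: errB_ge1.
lra.
Qed.

(** * Invariance of the constraint *)

Lemma constraint_of_errB_le Q K : B Q <= K ->
  p Q < cos theta ->
  p Q <= cos theta - (1 + cos theta) * expR (alpha * (1 - K)).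
Proof.
move=> BK pc; have c1 : 0 < 1 + cos theta by rewrite ltr_wpDr.
have y0 : 0 < (cos theta - p Q) / (1 + cos theta) by rewrite divr_gt0 ?subr_gt0.
have : expR (alpha * (1 - K)) <= (cos theta - p Q) / (1 + cos theta).
  rewrite -[leRHS]lnK // ler_expR -ler_pdivlMl //.
  by move: BK; rewrite /errB; lra.
by rewrite ler_pdivlMr // [_ * expR _]mulrC; lra.
Qed.

(** At the first exit time [t] the logarithm in B takes a default value, so the energy carries no
    information there. The contradiction is found just before [t]: the energy bounds B by a
    constant, hence [p] stays below [cos theta] by a fixed margin, although it tends to a value at
    least [cos theta]. *)
Lemma loop_constraint T x : loop T x -> p (x 0).1 < cos theta ->
  forall t, horizon T t -> p (x t).1 < cos theta.
Proof.
move=> lx p0 t1 Tt1; rewrite ltNge; apply/negP => p1.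
have xc : {within horizon T, continuous x} by case: lx.
have pc : {within horizon T, continuous (fun s => p (x s).1)}.
  move/subspace_continuousP : xc => xc; apply/subspace_continuousP => s Ts.
  apply: cvg_pointing; apply: (@continuous_cvg _ _ _ _ _ x fst); last exact: xc.
  exact: cvg_fst.
have [t [t0 tt1 pt ps]] := first_exit pc p0 Tt1 p1.
have Tt := horizonW Tt1 (ltW t0) tt1.
have [dOm [[dQ _] _ _]] := loop_derive lx Tt t0.
have cQ : (x s).1 @[s --> t^'-] --> (x t).1.
  apply: cvg_at_left_filter.
  apply: (@differentiable_continuous _ _ _ t (fun s => (x s).1)).
  exact/derivable1_diffP.
have At : 0 < A (x t).1.
  apply: (errA_gt0 m_gt0 g_ge Rd_SO3 (loop_SO3 lx Tt)).
  by apply: contraTneq pt => ->; rewrite -ltNge.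
(* Just before [t], A exceeds half of its value at [t], so that [energy (x 0)] is at least
   [kR * (A (x t).1 / 2) * B]. The margin [h] is the one that [constraint_of_errB_le] gives for
   [K]. *)
pose K := energy (x 0) / (kR * (A (x t).1 / 2)).
pose h := (1 + cos theta) * expR (alpha * (1 - K)).
have h0 : 0 < h by rewrite mulr_gt0 ?expR_gt0 // ltr_wpDr.
have : \forall s \near t^'-, False.
  near=> s.
  have s0 : 0 < s by near: s; exact: nbhs_left_gt.
  have st : s < t by near: s; exact: nbhs_left_lt.
  have As : A (x t).1 / 2 < A (x s).1.
    near: s; apply: cvgr_gt; first exact: cvg_errA cQ.
    by lra.
  have hs : cos theta - h < p (x s).1.
    by near: s; apply: cvgr_gt; [exact: cvg_pointing cQ|lra].
  have Ts := horizonW Tt (ltW s0) (ltW st).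
  have SQ := loop_SO3 lx Ts.
  have pcs : p (x s).1 < cos theta by apply: ps; rewrite (ltW s0).
  have B1 : 1 <= B (x s).1 by exact: errB_ge1.
  have E0 : energy (x s) <= energy (x 0).
    apply: (energy_le lx _ (ltW s0) Ts _) => // u /andP[u0 us].
    by apply: ps; rewrite u0 (le_lt_trans us).
  suff /constraint_of_errB_le/(_ pcs) : B (x s).1 <= K.
    by rewrite -/h leNgt hs.
  have KE := posdef_ge0 J_posdef (x s).2.
  have k0 : 0 < kR * (A (x t).1 / 2) by apply: mulr_gt0 => //; exact: divr_gt0.
  rewrite /K ler_pdivlMr //.
  apply: le_trans E0; rewrite /energy.
  have : kR * (A (x t).1 / 2) * B (x s).1 <= kR * A (x s).1 * B (x s).1.
    by rewrite ler_wpM2r ?(le_trans ler01) // ler_pM2l // ltW.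
  by rewrite mulrA [B _ * _]mulrC; lra.
by move/filter_ex => [].
Unshelve. all: by end_near. Qed.

(** * Equivalence of errors and energy near the desired attitude *)

Definition coercive_at Q : Prop :=
  [/\ p Q < cos theta, 1 <= \tr (Rd^T *m Q),
      M * `|dotv (xi Q) (eRB r v theta alpha Q)| <= m / 2 & B Q <= B Rd + 1].

Lemma errA_Rd : A Rd = 0.
Proof. by rewrite /errA SO3_mulTmx // subrr mulmx0 mxtrace0 mulr0. Qed.

Lemma axis_Rd : xi Rd = 0.
Proof.
rewrite SO3_mulTmx // /axis trmx1 subrr.
apply/matrixP => i j; rewrite !mxE.
by elim/ord3P: i; rewrite /= ?mxE mulr0.
Qed.

Lemma eR_Rd : e Rd = 0.
Proof.
rewrite /eR errA_Rd scale0r addr0 eRA_trmx_mul SO3_mulTmx // trmx1 mulmx1.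
rewrite mul1mx subrr; apply/matrixP => i j; rewrite !mxE.
by elim/ord3P: i; rewrite /= ?mxE !mulr0.
Qed.

(** Each condition holds with room to spare at [Rd], where the trace is 3 and xi is 0. The trace
    condition serves [errA_le_axis], the third one lets the [eRA] term absorb the [eRB] term in
    [axis_eR_ge], and the last one makes A B comparable to A. *)
Lemma near_coercive : \forall Q \near Rd, coercive_at Q.
Proof.
have cid : (Q : 'M[R]_3) @[Q --> Rd] --> Rd by exact: cvg_id.
have c1 : (p Q) @[Q --> Rd] --> p Rd by exact: (cvg_pointing cid).
have cP : (Rd^T *m Q) @[Q --> Rd] --> Rd^T *m Rd.
  exact: (cvg_mulmx (cvg_cst Rd^T) cid).
have c2 : \tr (Rd^T *m Q) @[Q --> Rd] --> (3%:R : R).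
  by rewrite -(mxtrace1 R 3) -(SO3_mulTmx Rd_SO3); exact: cvg_mxtrace cP.
have c3 : B Q @[Q --> Rd] --> B Rd.
  exact: (cvg_errB cid cos_ge0 Rd_constraint).
have c4 : dotv (xi Q) (eRB r v theta alpha Q) @[Q --> Rd] --> (0 : R).
  have <- : dotv (xi Rd) (eRB r v theta alpha Rd) = 0.
    by rewrite axis_Rd /dotv trmx0 mul0mx mxE.
  exact: cvg_dotv (cvg_axis cP) (cvg_eRB cid alpha_gt0 Rd_constraint).
have M0 := M_gt0.
near=> Q; split.
- by near: Q; exact: cvgr_lt c1 _ Rd_constraint.
- apply: ltW; near: Q; apply: (cvgr_gt _ c2).
  by rewrite ltr1n.
- rewrite mulrC -ler_pdivlMr //; apply: ltW; near: Q.
  by apply: (cvgr0_norm_lt _ c4); rewrite !divr_gt0.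
- by apply: ltW; near: Q; apply: (cvgr_lt _ c3); rewrite ltrDl.
Unshelve. all: by end_near. Qed.

Lemma axis_sqr_le1 Q : SO3 Q -> dotv (xi Q) (xi Q) <= 1.
Proof.
move=> /(SO3_trmx_mul Rd_SO3)/SO3_axis_sqr E.
by have := sqr_ge0 (\tr (Rd^T *m Q) - 1); lra.
Qed.

Lemma axis_sqr_le_eR Q : SO3 Q -> coercive_at Q ->
  dotv (xi Q) (xi Q) <= 4 / m ^+ 2 * dotv (e Q) (e Q).
Proof.
move=> SQ [pc t1 small _].
have m20 : 0 < m / 2 by rewrite divr_gt0.
have H : m / 2 * dotv (xi Q) (xi Q) <= dotv (xi Q) (e Q).
  exact: axis_eR_ge small.
(* With weight [m / 2], Young's inequality spends half of the left-hand side of [H] and leaves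
   [m / 4 * X <= E / m]. *)
have Y := le_trans (ler_norm _) (dotv_young (xi Q) (e Q) m20).
have {H Y} := le_trans H Y.
set X := dotv (xi Q) (xi Q); set E := dotv (e Q) (e Q).
have -> : (2 * (m / 2))^-1 * E = E / m by field; rewrite gt_eqF.
have -> : 4 / m ^+ 2 * E = 4 / m * (E / m) by field; rewrite gt_eqF.
move=> H; rewrite mulrAC ler_pdivlMr //; lra.
Qed.

Lemma energy_le_quadratic : exists2 C, 0 < C & forall y, SO3 y.1 ->
  coercive_at y.1 -> energy y <= C * (dotv (xi y.1) (xi y.1) + dotv y.2 y.2).
Proof.
have [K K0 KP] := mulmx_dotvv_le J.
have B1 : 1 <= B Rd by exact: errB_ge1.
(* The potential part is bounded through [errA <= M |xi|^2] and [B <= B Rd + 1]; the terms [1 + K]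
   of the final constant cover the kinetic part. *)
pose C1 := kR * (M * (B Rd + 1)).
have C10 : 0 < C1.
  apply: mulr_gt0 => //; apply: mulr_gt0; first exact: M_gt0; lra.
exists (C1 + 1 + K) => [|y Sy cy]; first by rewrite !addr_gt0.
have [pc t1 _ BC] := cy.
have X0 := dotvv_ge0 (xi y.1); have O0 := dotvv_ge0 y.2.
have Y := le_trans (ler_norm _) (dotv_young y.2 (J *m y.2) (@ltr01 R)).
have KO := KP y.2.
have A0 := errA_ge0 m_gt0 g_ge Rd_SO3 Sy.
have AB : kR * (A y.1 * B y.1) <= C1 * dotv (xi y.1) (xi y.1).
  rewrite /C1 -[leRHS]mulrA ler_pM2l // [leRHS]mulrAC; apply: ler_pM => //.
    by apply: le_trans ler01 _; exact: errB_ge1.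
  exact: (errA_le_axis m_gt0 g_ge g_le).
have C1O : 0 <= C1 * dotv y.2 y.2 by rewrite mulr_ge0 // ltW.
have KX : 0 <= K * dotv (xi y.1) (xi y.1) by rewrite mulr_ge0 // ltW.
have KO0 : 0 <= K * dotv y.2 y.2 by rewrite mulr_ge0 // ltW.
by rewrite /energy; lra.
Qed.

Lemma error_lt_of_energy eps : 0 < eps -> exists2 mu, 0 < mu &
  forall y, SO3 y.1 -> p y.1 < cos theta -> energy y < mu ->
  `|attitude_error (diag_mx g) Rd r v theta alpha y| < eps.
Proof.
move=> eps0; have [k k0 kP] := posdef_ge_dotvv J_posdef.
have eN : \forall Q \near Rd, `|e Q| < eps.
  have ce : e Q @[Q --> Rd] --> (0 : 'cV[R]_3).
    by rewrite -eR_Rd; exact: (cvg_eR (@cvg_id _ (nbhs Rd)) alpha_gt0 cos_ge0).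
  exact: cvgr0_norm_lt ce _ eps0.
have [a a0 aP] := near_errA_lt m_gt0 g_ge Rd_SO3 eN.
(* The first bound gives [A < a], since [kR * A] is at most the energy. The second one gives
   [dotv y.2 y.2 < eps ^+ 2], since that inner product is at most [2 * k] times the energy. *)
exists (Num.min (kR * a) (eps ^+ 2 / (2 * k))).
  by rewrite lt_min mulr_gt0 //= divr_gt0 ?exprn_gt0 ?mulr_gt0.
move=> y Sy pc; rewrite lt_min => /andP[E1 E2].
rewrite prod_norm_lt; apply/andP; split.
  apply: aP => //; rewrite -(ltr_pM2l kR_gt0).
  exact: le_lt_trans (errA_le_energy Sy pc) E1.
apply: cV_norm_lt => //; apply: le_lt_trans (kP y.2) _.
move: E2; rewrite ltr_pdivlMr ?mulr_gt0 // => E2; apply: le_lt_trans E2.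
have := kinetic_le_energy Sy pc; rewrite -(ler_pM2l k0); lra.
Qed.

Lemma energy_lt_of_error mu : 0 < mu -> exists2 delta, 0 < delta &
  forall y, SO3 y.1 -> coercive_at y.1 ->
  `|attitude_error (diag_mx g) Rd r v theta alpha y| < delta -> energy y < mu.
Proof.
move=> mu0; have [C C0 CP] := energy_le_quadratic.
have m4 : 0 < 4 / m ^+ 2 by rewrite divr_gt0 ?exprn_gt0.
(* The terms [4 / m ^+ 2] and 1 are the costs of bounding xi by [e] and of the velocity itself; 3 is
   the loss from the maximum norm to the Euclidean one. *)
pose D := C * (4 / m ^+ 2 + 1) * 3.
have D0 : 0 < D by rewrite mulr_gt0 // mulr_gt0 // addr_gt0.
exists (Num.sqrt (mu / D)); first by rewrite sqrtr_gt0 divr_gt0.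
move=> y Sy cy; rewrite prod_norm_lt /= => /andP[e1 e2].
have lt_sqr (z : 'cV[R]_3) : `|z| < Num.sqrt (mu / D) ->
    dotv z z < 3 * (mu / D).
  move=> zlt; apply: le_lt_trans (dotvv_le_norm z) _.
  rewrite ltr_pM2l // -[ltRHS]sqr_sqrtr; last by rewrite ltW // divr_gt0.
  by rewrite ltr_pXn2r ?nnegrE ?sqrtr_ge0.
have {e1}E1 := lt_sqr _ e1; have {e2}E2 := lt_sqr _ e2.
apply: le_lt_trans (CP y Sy cy) _.
have -> : mu = C * (4 / m ^+ 2 * (3 * (mu / D)) + 3 * (mu / D)).
  rewrite /D; field; rewrite !gt_eqF //= addr_gt0 // exprn_gt0 //.
rewrite ltr_pM2l // ler_ltD //.
apply: le_trans (axis_sqr_le_eR Sy cy) _.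
by rewrite ler_pM2l // ltW.
Qed.

(** * The cross term and the strict Lyapunov function *)

Definition cross y : R := dotv (xi y.1) (J *m y.2).

Definition dcross y : R :=
  dotv (axis (Rd^T *m y.1 *m hat y.2)) (J *m y.2) +
  dotv (xi y.1) (- (kR *: e y.1) - kOmega *: y.2).

Lemma continuous_cross y : {for y, continuous cross}.
Proof.
have c1 : z.1 @[z --> y] --> y.1 by exact: cvg_fst.
have c2 : z.2 @[z --> y] --> y.2 by exact: cvg_snd.
apply: cvg_dotv; last by apply: cvg_mulmx => //; exact: cvg_cst.
by apply: cvg_axis; apply: cvg_mulmx => //; exact: cvg_cst.
Qed.

Lemma is_derive_cross T x t : loop T x -> horizon T t -> 0 < t ->
  is_derive t 1 (fun s => cross (x s)) (dcross (x t)).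
Proof.
move=> lx Tt t0; have [dOm [dQ dO JO]] := loop_derive lx Tt t0.
have d := is_derive_dotv (is_derive_axis (is_derive_mulmxr Rd^T dQ))
  (is_derive_mulmxr J dO).
by apply: is_derive_eq d _; rewrite JO /dcross mulmxA.
Qed.

Lemma dcross_le : exists2 N, 0 < N & forall y, SO3 y.1 -> coercive_at y.1 ->
  dcross y <= N * dotv y.2 y.2 - kR * m / 4 * dotv (xi y.1) (xi y.1).
Proof.
have [K K0 KP] := mulmx_dotvv_le J.
(* This weight makes the friction term cost [kR * m / 4] times |xi|^2, half of what [axis_eR_ge]
   provides. *)
pose a := kR * m / (2 * kOmega).
have a0 : 0 < a by rewrite divr_gt0 ?mulr_gt0.
exists (1 + K + kOmega / (2 * a)) => [|y Sy [pc t1 small _]].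
  by rewrite !addr_gt0 // divr_gt0 // mulr_gt0.
have SP := SO3_trmx_mul Rd_SO3 Sy.
have D := SO3_axis_mul_hat y.2 SP.
have Y := le_trans (ler_norm _) (dotv_young
  (axis (Rd^T *m y.1 *m hat y.2)) (J *m y.2) (@ltr01 R)).
have KO := KP y.2.
have E : m / 2 * dotv (xi y.1) (xi y.1) <= dotv (xi y.1) (e y.1).
  exact: axis_eR_ge small.
have Z := dotv_young (xi y.1) y.2 a0.
have {}Z : - (kOmega * dotv (xi y.1) y.2) <=
    kR * m / 4 * dotv (xi y.1) (xi y.1) + kOmega / (2 * a) * dotv y.2 y.2.
  have -> : kR * m / 4 * dotv (xi y.1) (xi y.1) +
      kOmega / (2 * a) * dotv y.2 y.2 =
      kOmega * (a / 2 * dotv (xi y.1) (xi y.1) + (2 * a)^-1 * dotv y.2 y.2).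
    by rewrite /a; field; rewrite !gt_eqF // mulr_gt0.
  rewrite -mulrN ler_pM2l //; apply: le_trans Z.
  by rewrite -normrN ler_norm.
have {}E : kR * (m / 2 * dotv (xi y.1) (xi y.1)) <= kR * dotv (xi y.1) (e y.1).
  by rewrite ler_pM2l.
have O0 := dotvv_ge0 y.2.
have KO0 : 0 <= K * dotv y.2 y.2 by rewrite mulr_ge0 // ltW.
rewrite /dcross dotvDr !dotvNr (dotvZr kR) (dotvZr kOmega); lra.
Qed.

(* A large multiple of the energy plus the cross term is a strict Lyapunov
   function: as long as the energy stays away from 0, it would decrease at a
   constant rate, while it is bounded below. *)
Lemma energy_cvg0 x mu : loop +oo%E x ->
  (forall t, 0 <= t -> coercive_at (x t).1) -> 0 < mu ->
  exists2 t0, 0 <= t0 & forall t, t0 <= t -> energy (x t) < mu.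
Proof.
move=> lx cx mu0.
have hT t : 0 <= t -> horizon +oo%E t by move=> t0; split=> //; exact: ltry.
have px t : 0 <= t -> p (x t).1 < cos theta by move=> /cx[].
suff [t0 t00 Et0] : exists2 t0, 0 <= t0 & energy (x t0) < mu.
  exists t0 => // t t0t; apply: le_lt_trans Et0.
  apply: (energy_le lx t00 t0t (hT _ (le_trans t00 t0t))) => s /andP[t0s _].
  exact/px/(le_trans t00).
apply: contrapT => noE.
have Emu t : 0 <= t -> mu <= energy (x t).
  by move=> t0; rewrite leNgt; apply/negP => Et; apply: noE; exists t.
have [C C0 CP] := energy_le_quadratic.
have [N N0 NP] := dcross_le.
have [K K0 KP] := mulmx_dotvv_le J.
have [k k0 kP] := posdef_ge_dotvv J_posdef.
have E00 : 0 < energy (x 0) by apply: lt_le_trans mu0 (Emu _ _).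
(* As [N' * kOmega = N + 1], the energy compensates the [N] of [dcross_le] and leaves a coefficient
   -1 on |Omega|^2, next to [- kR * m / 4] on |xi|^2. By [CP] and [mu <= energy], the rate is then
   at least [kap * mu / C]. *)
pose kap := Num.min 1 (kR * m / 4).
have kap0 : 0 < kap by rewrite lt_min ltr01 divr_gt0 ?mulr_gt0.
pose N' := (N + 1) / kOmega.
have N'0 : 0 < N' by rewrite divr_gt0 // addr_gt0.
pose W y := N' * energy y + cross y.
have W_lb t : 0 <= t -> - (1 + K * (2 * k * energy (x 0))) <= W (x t).
  move=> t0; have Sx := loop_SO3 lx (hT t t0).
  have E0 : energy (x t) <= energy (x 0).
    apply: (energy_le lx (lexx 0) t0 (hT t t0)) => s /andP[s0 _]; exact: px.
  have Et := lt_le_trans mu0 (Emu t t0).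
  have NE : 0 <= N' * energy (x t) by rewrite mulr_ge0 // ltW.
  have Y := dotv_young (xi (x t).1) (J *m (x t).2) (@ltr01 R).
  have {}Y : - (cross (x t)) <= 1 / 2 * dotv (xi (x t).1) (xi (x t).1) +
      (2 * 1)^-1 * dotv (J *m (x t).2) (J *m (x t).2).
    by apply: le_trans Y; rewrite -normrN ler_norm.
  have X1 := axis_sqr_le1 Sx.
  have OO : dotv (x t).2 (x t).2 <= 2 * k * energy (x 0).
    apply: le_trans (kP _) _; rewrite -mulrA mulrCA ler_pM2l //.
    by have := kinetic_le_energy Sx (px t t0); lra.
  have KO := KP (x t).2.
  have {}OO : K * dotv (x t).2 (x t).2 <= K * (2 * k * energy (x 0)).
    by rewrite ler_pM2l.
  have KE : 0 <= K * (2 * k * energy (x 0)).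
    by rewrite mulr_ge0 ?mulr_ge0 // ltW.
  by rewrite /W; lra.
have W_decr b : 0 <= b -> W (x b) - W (x 0) <= - (kap * mu / C) * (b - 0).
  move=> b0; have xc : {within horizon +oo%E, continuous x} by case: lx.
  apply: (increment_le (phi := W) (dphi := fun t =>
    N' * (- (kOmega * dotv (x t).2 (x t).2)) + dcross (x t))
    xc (lexx 0) b0 (hT b b0)) => [t /andP[t0 _]|t /andP[t0 _]].
    apply: cvgD; last exact: continuous_cross.
    by apply: cvgM; [exact: cvg_cst|exact/continuous_energy/px].
  have t0' := ltW t0; split.
    apply: is_deriveD; last exact: is_derive_cross (hT _ t0') t0.
    apply: (is_deriveZ N').
    exact: is_derive_energy lx (hT _ t0') t0 (px _ t0').
  have Sx := loop_SO3 lx (hT t t0').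
  have CE := le_trans (Emu t t0') (CP _ Sx (cx t t0')).
  have ND := NP _ Sx (cx t t0').
  have X0 := dotvv_ge0 (xi (x t).1); have O0 := dotvv_ge0 (x t).2.
  have kO : kap * dotv (x t).2 (x t).2 <= 1 * dotv (x t).2 (x t).2.
    by rewrite ler_wpM2r // ge_min lexx.
  have kX : kap * dotv (xi (x t).1) (xi (x t).1) <=
      kR * m / 4 * dotv (xi (x t).1) (xi (x t).1).
    by rewrite ler_wpM2r // ge_min lexx orbT.
  have NO : N' * - (kOmega * dotv (x t).2 (x t).2) =
      - ((N + 1) * dotv (x t).2 (x t).2).
    by rewrite /N'; field; rewrite gt_eqF.
  have kC : kap * mu / C <=
      kap * (dotv (xi (x t).1) (xi (x t).1) + dotv (x t).2 (x t).2).
    by rewrite ler_pdivrMr // -mulrA ler_pM2l // mulrC.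
  by rewrite NO; lra.
pose L := 1 + K * (2 * k * energy (x 0)).
have L0 : 0 < L by rewrite addr_gt0 // !mulr_gt0.
have W0 : - L <= W (x 0) by exact: W_lb.
(* By time [b] the decrease reaches [W (x 0) + L + 1], one more than the lower bound [- L]
   allows. *)
pose b := (W (x 0) + L + 1) / (kap * mu / C).
have r0 : 0 < kap * mu / C by rewrite divr_gt0 // mulr_gt0.
have b0 : 0 <= b by rewrite divr_ge0 ?(ltW r0) //; lra.
have := W_decr b b0; have := W_lb b b0; rewrite -/L subr0 mulNr mulrC.
by rewrite /b divfK ?gt_eqF //; lra.
Qed.

(** * Asymptotic stability and the final statement *)

Lemma loop_asymptotically_stable :
  asymptotically_stable loop
    (attitude_error (diag_mx g) Rd r v theta alpha) (Rd, 0).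
Proof.
have error_Rd : attitude_error (diag_mx g) Rd r v theta alpha (Rd, 0) = 0.
  by rewrite /attitude_error /= eR_Rd.
split=> //.
  split=> //.
  - by move=> t; exact: cst_continuous.
  - move=> t _ _; split; rewrite ?derive1_cst //.
      rewrite /control /= eR_Rd /eOmega !scaler0 oppr0 !add0r.
      by rewrite !mulmx0 add0r.
    rewrite (_ : hat 0 = 0) ?mulmx0 //.
    by apply/matrixP; elim/ord3P; elim/ord3P; rewrite !mxE /= ?mxE ?oppr0.
(* At time 0 this zone turns a small error into a small energy. Stability needs nothing more, since
   afterwards the energy and the constraint suffice to bound the error. *)
exists [set y | coercive_at y.1].
  exact: (cvg_fst near_coercive).
have stay T x mu : loop T x -> coercive_at (x 0).1 -> energy (x 0) < mu ->
  forall t, horizon T t ->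
    [/\ SO3 (x t).1, p (x t).1 < cos theta & energy (x t) < mu].
  move=> lx [p0 _ _ _] E0 t Tt; have pc := loop_constraint lx p0.
  split; [exact: loop_SO3 lx Tt|exact: pc|apply: le_lt_trans E0].
  apply: (energy_le lx (lexx 0) Tt.1 Tt) => s /andP[s0 st].
  exact/pc/(horizonW Tt).
have start T x : loop T x -> SO3 (x 0).1.
  by move=> lx; apply: (loop_SO3 lx); split=> //; case: lx.
split=> [eps eps0|].
  have [mu mu0 muP] := error_lt_of_energy eps0.
  have [delta delta0 deltaP] := energy_lt_of_error mu0.
  exists delta => // T x lx cx0 /(deltaP _ (start _ _ lx) cx0) E0 t Tt.
  by have [St pt Et] := stay _ _ _ lx cx0 E0 t Tt; exact: muP.
(* Convergence also needs the trajectory to remain in the zone: an energy below [kR * a] keeps A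
   below [a] for ever. *)
have [a a0 aP] := near_errA_lt m_gt0 g_ge Rd_SO3 near_coercive.
have [delta delta0 deltaP] := energy_lt_of_error (mulr_gt0 kR_gt0 a0).
exists delta => // x lx cx0 /(deltaP _ (start _ _ lx) cx0) E0.
have hT t : 0 <= t -> horizon +oo%E t by move=> t0; split=> //; exact: ltry.
have cx t : 0 <= t -> coercive_at (x t).1.
  move=> t0; have [St pt Et] := stay _ _ _ lx cx0 E0 t (hT t t0).
  apply: aP => //; rewrite -(ltr_pM2l kR_gt0).
  exact: le_lt_trans (errA_le_energy St pt) Et.
apply/cvgr0Pnorm_lt => eps eps0.
have [mu mu0 muP] := error_lt_of_energy eps0.
have [t0 t00 Et] := energy_cvg0 lx cx mu0.
near=> t; have t0t : t0 <= t by near: t; apply: nbhs_pinfty_ge; exact: num_real.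
have t_ge0 := le_trans t00 t0t.
have [pt _ _ _] := cx t t_ge0.
by apply: muP => //; [exact: loop_SO3 lx (hT t t_ge0)|exact: Et].
Unshelve. all: by end_near. Qed.

End ClosedLoop.

Theorem proposition3 (R : realType) (J : 'M[R]_3) (r v : 'cV[R]_3)
    (theta alpha : R) (g : 'rV[R]_3) (Rd : 'M[R]_3) (kR kOmega : R)
    (J_posdef : posdefmx J)
    (r_unit : unit_vector r) (v_unit : unit_vector v)
    (theta_ge0 : 0 <= theta) (theta_le : theta <= pi / 2)
    (alpha_gt0 : 0 < alpha)
    (g_gt0 : forall i, 0 < g 0 i) (g_inj : injective (fun i => g 0 i))
    (Rd_SO3 : SO3 Rd) (Rd_constraint : pointing r v Rd < cos theta)
    (kR_gt0 : 0 < kR) (kOmega_gt0 : 0 < kOmega) :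
  let G := diag_mx g in
  let closed_loop :=
    rigid_body_trajectory J (control G Rd r v theta alpha J kR kOmega) in
  asymptotically_stable closed_loop (attitude_error G Rd r v theta alpha)
    (Rd, 0) /\
  (forall T x, closed_loop T x -> pointing r v (x 0).1 < cos theta ->
   forall t, horizon T t -> pointing r v (x t).1 <= cos theta).
Proof.
have cos_ge0 : 0 <= cos theta.
  apply: cos_ge0_pihalf; rewrite theta_le andbT.
  by rewrite (le_trans _ theta_ge0) // oppr_le0 divr_ge0 // pi_ge0.
pose m := Num.min (g 0 0) (Num.min (g 0 1) (g 0 2)).
have m_gt0 : 0 < m by rewrite !lt_min !g_gt0.
have g_ge i : m <= g 0 i.
  by elim/ord3P: i; rewrite !ge_min lexx ?orbT.
(* Any upper bound of the gains can serve as [M]; the sum spares a maximum. *)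
have g_le i : g 0 i <= \sum_j g 0 j.
  rewrite (bigD1 i) //= lerDl; apply: sumr_ge0 => j _; exact: ltW.
move=> G closed_loop; split.
  exact: (loop_asymptotically_stable (m := m) (M := \sum_j g 0 j)).
move=> T x lx p0 t Tt; apply: ltW.
exact: (loop_constraint J_posdef r_unit v_unit cos_ge0 alpha_gt0 m_gt0 g_ge
  Rd_SO3 Rd_constraint kR_gt0 kOmega_gt0 lx p0 Tt).
Qed.
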